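(* Let $G=(V,D,B)$ be a mixed graph with mixed components $G[C]=(V[C],D[C],B[C])$ for $C\in\mathcal{C}(G)$. Then there is an invertible map $\tau$ from $\mathit{PD}_V$ to $\prod_{C\in\mathcal{C}(G)}\mathit{PD}_{V[C]}$ such that the following diagram commutes: the top arrow is $\phi_G:\mathbb{R}^D_{\mathrm{reg}}\times\mathit{PD}(B)\to\mathit{PD}_V$; the bottom arrow is $(\phi_{G[C]})_{C\in\mathcal{C}(G)}:\prod_{C\in\mathcal{C}(G)}\mathbb{R}^{D[C]}_{\mathrm{reg}}\times\mathit{PD}_I(B[C])\to\prod_{C\in\mathcal{C}(G)}\mathit{PD}_{V[C]}$; the left vertical arrow is the invertible map $\pi=(\pi_C)_{C\in\mathcal{C}(G)}:\mathbb{R}^D_{\mathrm{reg}}\times\mathit{PD}(B)\to\prod_{C\in\mathcal{C}(G)}\mathbb{R}^{D[C]}_{\mathrm{reg}}\times\mathit{PD}_I(B[C])$; and the right vertical arrow is the invertible map $\tau:\mathit{PD}_V\to\prod_{C\in\mathcal{C}(G)}\mathit{PD}_{V[C]}$. In other words, $$\tau\circ\phi_G \;=\; \big(\phi_{G[C]}\circ\pi_C\big)_{C\in\mathcal{C}(G)}.$$ Both $\tau$ and its inverse are rational maps, defined on all of $\mathit{PD}_V$ and all of $\prod_{C\in\mathcal{C}(G)}\mathit{PD}_{V[C]}$, respectively.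
   Context: A mixed graph $G=(V,D,B)$ has a finite vertex set $V$, a set $D\subseteq V\times V$ of directed edges $i\to j$, and a set $B$ of bidirected edges, which are unordered pairs $i\leftrightarrow j$; there are no loops ($i\to i\notin D$, $i\leftrightarrow i\notin B$). Directed cycles are allowed. The parents of $i$ are $\mathrm{pa}(i)=\{j\in V: j\to i\in D\}$. $\mathbb{R}^D$ is the set of real $V\times V$ matrices $\Lambda=(\lambda_{ij})$ with $\lambda_{ij}=0$ if $i\to j\notin D$, and $\mathbb{R}^D_{\mathrm{reg}}$ is the subset of those $\Lambda$ with $I-\Lambda$ invertible. $\mathit{PD}_V$ is the cone of positive definite symmetric $V\times V$ matrices, and $\mathit{PD}(B)=\{\Omega=(\omega_{ij})\in\mathit{PD}_V:\omega_{ij}=0 \text{ if } i\ne j \text{ and } i\leftrightarrow j\notin B\}$. The map $\phi_G:\mathbb{R}^D_{\mathrm{reg}}\times\mathit{PD}(B)\to\mathit{PD}_V$ is $\phi_G(\Lambda,\Omega)=(I-\Lambda)^{-T}\Omega(I-\Lambda)^{-1}$. The same notation is used for any mixed graph, with its own vertex set in place of $V$. $\mathcal{C}(G)$ is the partition of $V$ that is the finest common coarsening of (1) the partition into connected components of the bidirected part $(V,B)$ and (2) the partition into strongly connected components of the digraph $(V,D)$. For $C\in\mathcal{C}(G)$ let $V[C]=C\cup\bigcup_{i\in C}\mathrm{pa}(i)$, let $D[C]=D\cap(V[C]\times C)$, and let $B[C]$ be the set of bidirected edges in $B$ with both endpoints in $C$. The mixed graphs $G[C]=(V[C],D[C],B[C])$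 are the mixed components of $G$. Let $\mathit{PD}_I(B[C])$ be the set of $V[C]\times V[C]$ matrices $\Omega=(\omega_{ij})\in\mathit{PD}(B[C])$ with $\omega_{ii}=1$ for all $i\in V[C]\setminus C$. For $C\in\mathcal{C}(G)$ define $\pi_C(\Lambda,\Omega)=(\pi_C^{\to}(\Lambda),\pi_C^{\leftrightarrow}(\Omega))$, where $\pi_C^{\to}(\Lambda)$ and $\pi_C^{\leftrightarrow}(\Omega)$ are the $V[C]\times V[C]$ matrices with entries: $\pi_C^{\to}(\Lambda)_{ij}=\lambda_{ij}$ if $j\in C$, and $0$ if $j\in V[C]\setminus C$; $\pi_C^{\leftrightarrow}(\Omega)_{ij}=\omega_{ij}$ if $i,j\in C$, $1$ if $i=j\in V[C]\setminus C$, and $0$ otherwise. A rational map defined on all of a set is a map whose coordinates are rational functions of the matrix entries that are defined at every point of that set.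
   Formalization: As stated, τ cannot be a bijection of PD_V with the whole product (two isolated vertices: τ is not injective). Proved instead: τ and its inverse, rational on all of both cones, are mutually inverse between the images of φ_G and of (φ_{G[C]})_C. *)

(* Defs.v *)
From HB Require Import structures.
From mathcomp Require Import all_boot all_order all_algebra.

Set Implicit Arguments.
Unset Strict Implicit.
Unset Printing Implicit Defensive.

Import Order.TTheory GRing.Theory Num.Theory.
Local Open Scope ring_scope.

(* [dir G i j] is the directed edge i -> j and [bidir G i j] the bidirected
   edge i <-> j. *)
Record mixed_graph (V : finType) := MixedGraph {
  dir : rel V;
  bidir : rel V;
  dir_irr : irreflexive dir;
  bidir_irr : irreflexive bidir;
  bidir_sym : symmetric bidir }.

(* T x T matrices are the square matrices of size #|T|, where [enum_rank] and
   [enum_val] translate between elements of T and positions. *)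
Definition entry (R : Type) (T : finType) (A : 'M[R]_#|T|) (i j : T) : R :=
  A (enum_rank i) (enum_rank j).

Definition mx_of (R : Type) (T : finType) (f : T -> T -> R) : 'M[R]_#|T| :=
  \matrix_(a, b) f (enum_val a) (enum_val b).

Lemma entry_mx_of (R : Type) (T : finType) (f : T -> T -> R) i j :
  entry (mx_of f) i j = f i j.
Proof. by rewrite /entry mxE !enum_rankK. Qed.

Lemma mx_of_entry (R : Type) (T : finType) (A : 'M[R]_#|T|) :
  mx_of (entry A) = A.
Proof. by apply/matrixP => a b; rewrite mxE /entry !enum_valK. Qed.

Section Partitions.
Variable V : finType.
Implicit Types P Q S : {set {set V}}.

Definition coarser P S : bool :=
  [forall (A | A \in P), exists B in S, A \subset B].

(* The join of two partitions of V; see [common_coarseningP]. *)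
Definition common_coarsening P Q : {set {set V}} :=
  equivalence_partition
    (connect (fun i j => (pblock P i == pblock P j)
                      || (pblock Q i == pblock Q j))) [set: V]%SET.

Lemma common_coarseningP P Q (J := common_coarsening P Q) :
    partition P [set: V]%SET -> partition Q [set: V]%SET ->
  [/\ partition J [set: V]%SET, coarser P J, coarser Q J
    & forall S, partition S [set: V]%SET ->
        coarser P S -> coarser Q S -> coarser J S].
Proof.
move=> pP pQ; pose e := fun i j => (pblock P i == pblock P j)
  || (pblock Q i == pblock Q j).
have esym : connect_sym e.
  by apply: sym_connect_sym => i j; rewrite /e eq_sym [X in _ || X]eq_sym.
have eqv : {in [set: V]%SET & &, equivalence_rel (connect e)}.
  move=> x y z _ _ _; split; first exact: connect0.
  by move=> exy; apply: (same_connect esym).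
have pJ : partition J [set: V]%SET by apply: equivalence_partitionP.
have inblock S x : partition S [set: V]%SET -> x \in pblock S x.
  by move=> /and3P[/eqP cS _ _]; rewrite mem_pblock cS inE.
have blockE S A x : partition S [set: V]%SET -> A \in S -> x \in A ->
    pblock S x = A.
  by move=> /and3P[_ tS _] AS xA; apply: def_pblock.
have memb S x : partition S [set: V]%SET -> pblock S x \in S.
  by move=> /and3P[/eqP cS _ _]; rewrite pblock_mem // cS inE.
have sub S : partition S [set: V]%SET ->
    (forall x y, pblock S x = pblock S y -> e x y) -> coarser S J.
  move=> pS eS; apply/forall_inP => A AS.
  have /set0Pn[x xA] : A != set0.
    by apply: contraTneq AS => ->; case/and3P: pS.
  apply/exists_inP; exists (pblock J x); first exact: memb.
  apply/subsetP => y yA.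
  rewrite (pblock_equivalence_partition eqv) ?inE //.
  by apply: connect1; apply: eS; rewrite !(blockE _ A).
split=> //.
- by apply: sub => // x y exy; rewrite /e exy eqxx.
- by apply: sub => // x y exy; rewrite /e exy eqxx orbT.
move=> S pS cP cQ; apply/forall_inP => A AJ.
have /set0Pn[x xA] : A != set0.
  by apply: contraTneq AJ => ->; case/and3P: pJ.
apply/exists_inP; exists (pblock S x); first exact: memb.
apply/subsetP => y; rewrite -(blockE _ _ _ pJ AJ xA).
rewrite (pblock_equivalence_partition eqv) ?inE // => exy.
have step T u v : partition T [set: V]%SET -> coarser T S ->
    pblock T u = pblock T v -> pblock S u = pblock S v.
  move=> pT /forall_inP/(_ _ (memb _ u pT))/exists_inP[B BS /subsetP sB] euv.
  rewrite !(blockE _ B) // sB // ?inblock // euv; exact: inblock.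
have cl : closed e (pblock S x).
  have clS u v : e u v -> pblock S u = pblock S v.
    by case/orP=> /eqP; [apply: step | apply: step].
  move=> u v /clS euv; case/and3P: pS => /eqP cS tS _.
  rewrite -!eq_pblock ?cS ?inE //; first by rewrite euv.
by rewrite -(closed_connect cl exy) inblock.
Qed.

End Partitions.

Section MixedComponents.
Variables (V : finType) (G : mixed_graph V).

Definition bidirected_components : {set {set V}} :=
  equivalence_partition (connect (bidir G)) [set: V]%SET.

Definition strong_components : {set {set V}} :=
  equivalence_partition
    (fun i j => connect (dir G) i j && connect (dir G) j i) [set: V]%SET.

Definition mixed_partition : {set {set V}} :=
  common_coarsening bidirected_components strong_components.

Definition comp_index : finType := {C : {set V} | C \in mixed_partition}.

Definition pa (i : V) : {set V} := [set j | dir G j i]%SET.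

Definition vset (C : {set V}) : {set V} :=
  (C :|: \bigcup_(i in C) pa i)%SET.

Definition vcomp (C : comp_index) : finType := {i : V | i \in vset (val C)}.

Section Component.
Variable C : comp_index.

Definition dir_comp : rel (vcomp C) := fun i j =>
  dir G (val i) (val j) && (val j \in val C).

Definition bidir_comp : rel (vcomp C) := fun i j =>
  [&& bidir G (val i) (val j), val i \in val C & val j \in val C].

Lemma dir_comp_irr : irreflexive dir_comp.
Proof. by move=> i; rewrite /dir_comp dir_irr. Qed.

Lemma bidir_comp_irr : irreflexive bidir_comp.
Proof. by move=> i; rewrite /bidir_comp bidir_irr. Qed.

Lemma bidir_comp_sym : symmetric bidir_comp.
Proof. by move=> i j; rewrite /bidir_comp bidir_sym [X in _ && X]andbC. Qed.

Definition mixed_component : mixed_graph (vcomp C) :=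
  MixedGraph dir_comp_irr bidir_comp_irr bidir_comp_sym.

End Component.
End MixedComponents.

From mathcomp Require Import boolp classical_sets functions reals.
(* Loaded without Import: its notations clash with those of classical_sets. *)
From mathcomp Require mpoly.

Section Parametrization.
Variables (R : realType) (V : finType).

Definition PD : set 'M[R]_#|V| := fun A =>
  A^T = A /\ forall x : 'rV[R]_#|V|, x != 0 -> 0 < (x *m A *m x^T) 0 0.

Variable G : mixed_graph V.

Definition RD : set 'M[R]_#|V| := fun L =>
  forall i j, ~~ dir G i j -> entry L i j = 0.

Definition RDreg : set 'M[R]_#|V| := fun L =>
  RD L /\ 1%:M - L \in unitmx.

Definition PDB : set 'M[R]_#|V| := fun W =>
  PD W /\ forall i j, i != j -> ~~ bidir G i j -> entry W i j = 0.

Definition phi (p : 'M[R]_#|V| * 'M[R]_#|V|) : 'M[R]_#|V| :=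
  (invmx (1%:M - p.1))^T *m p.2 *m invmx (1%:M - p.1).

Definition params : set ('M[R]_#|V| * 'M[R]_#|V|) := fun p =>
  RDreg p.1 /\ PDB p.2.

Definition model : set 'M[R]_#|V| := fun S =>
  exists2 p, params p & phi p = S.

Lemma phi_PD : set_fun params PD phi.
Proof.
case=> L W [[_ uL] [[sW pW] _]]; rewrite /phi /= in uL sW pW *; split.
  by rewrite !trmx_mul trmxK sW mulmxA.
move=> x xN0; set M := invmx _.
have uM : M^T \in unitmx by rewrite unitmx_tr unitmx_inv.
have -> : x *m (M^T *m W *m M) *m x^T = (x *m M^T) *m W *m (x *m M^T)^T.
  by rewrite trmx_mul trmxK !mulmxA.
apply: pW; apply: contraNneq xN0 => xM0.
by rewrite -(mulmxK uM x) xM0 mul0mx.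
Qed.

End Parametrization.
Arguments PD R V : clear implicits.

Section Decomposition.
Variables (R : realType) (V : finType) (G : mixed_graph V).

Section Component.
Variable C : comp_index G.

Definition PDIB : set 'M[R]_#|vcomp C| := fun W =>
  PDB (mixed_component C) W /\
  forall i : vcomp C, val i \notin val C -> entry W i i = 1.

Definition pi_dir (L : 'M[R]_#|V|) : 'M[R]_#|vcomp C| :=
  mx_of (fun i j : vcomp C =>
    if val j \in val C then entry L (val i) (val j) else 0).

Definition pi_bidir (W : 'M[R]_#|V|) : 'M[R]_#|vcomp C| :=
  mx_of (fun i j : vcomp C =>
    if (val i \in val C) && (val j \in val C) then entry W (val i) (val j)
    else if (i == j) && (val i \notin val C) then 1 else 0).

Definition comp_params : set ('M[R]_#|vcomp C| * 'M[R]_#|vcomp C|) := fun p =>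
  RDreg (mixed_component C) p.1 /\ PDIB p.2.

End Component.

Definition comp_mx : Type := forall C : comp_index G, 'M[R]_#|vcomp C|.

Definition prod_PD : set comp_mx := fun S => forall C, PD R (vcomp C) (S C).

Definition comp_param : Type :=
  forall C : comp_index G, ('M[R]_#|vcomp C| * 'M[R]_#|vcomp C|)%type.

Definition prod_params : set comp_param := fun p =>
  forall C, comp_params (p C).

Definition pi_map (p : 'M[R]_#|V| * 'M[R]_#|V|) : comp_param :=
  fun C => (pi_dir C p.1, pi_bidir C p.2).

Definition prod_phi (p : comp_param) : comp_mx := fun C => phi (p C).

(* A map tau with tau (phi p) = prod_phi (pi_map p) on [params] need not be
   invertible between all of PD_V and all of the product: two isolated vertices
   rule out injectivity, the graph 1 -> 2 rules out surjectivity. Its inverse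
   is an inverse between the images [model] and [prod_model] of the two
   parametrizations. *)
Definition prod_model : set comp_mx := fun S =>
  exists2 p, prod_params p & prod_phi p = S.

End Decomposition.
Arguments comp_mx R {V} G.
Arguments prod_PD R {V} G.
Arguments prod_params R {V} G.
Arguments prod_model R {V} G.
Arguments pi_map R {V} G.
Arguments params R {V} G.
Arguments model R {V} G.

(* The points of X have real coordinates indexed by I. A rational function
   defined on all of A is a quotient p / q of polynomials in the coordinates
   such that q has no zero on A. *)
Definition rational_on (R : realType) (X : Type) (I : finType)
    (coord : X -> I -> R) (A : set X) (f : X -> R) : Prop :=
  exists p q : mpoly.mpoly #|I| R, forall x, A x ->
    let v := fun a : 'I_#|I| => coord x (enum_val a) in
    mpoly.meval v q != 0 /\ f x = mpoly.meval v p / mpoly.meval v q.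

Definition rational_map_on (R : realType) (X Y : Type) (I J : finType)
    (coordX : X -> I -> R) (coordY : Y -> J -> R) (A : set X) (f : X -> Y)
    : Prop :=
  forall j, rational_on coordX A (fun x => coordY (f x) j).

Definition mx_coord (R : realType) (V : finType) (A : 'M[R]_#|V|)
    (ij : V * V) : R :=
  entry A ij.1 ij.2.

Definition comp_mx_coord (R : realType) (V : finType) (G : mixed_graph V)
    (S : comp_mx R G) (c : {C : comp_index G & (vcomp C * vcomp C)%type}) : R :=
  entry (S (tag c)) (tagged c).1 (tagged c).2.

Arguments mx_coord R V : clear implicits.
Arguments comp_mx_coord R {V} G.

(* Main.v *)
(* Every positive definite S is (I - A)^-T D (I - A)^-1 for a unique A that is
   strictly upper triangular and a unique D that is diagonal, blockwise with
   respect to a ranking of V by which every edge between distinct strong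
   components goes up; the columns of A are regression coefficients, so A and D
   are rational in S. The map tau
   decomposes S in this way, applies pi_C to (A, D) and recomposes; its inverse
   decomposes every S_C, glues the pairs (A_C, D_C) along the columns indexed by
   C and recomposes.
   If S = phi(L, W), then A and D arise from I - L and W by a change of basis X,
   namely I - A = (I - L) X and D = X^T W X, where X is block diagonal with
   respect to the mixed partition: X is the triangular change of basis that
   diagonalizes W, followed by the inverses of the blocks of I - L on the strong
   components. Passing to a mixed component is multiplicative on such X, hence
   the component of (A, D) is the decomposition of phi(pi_C(L, W)). *)
Require Import Defs.
From mathcomp Require Import all_boot all_order all_algebra.
From mathcomp Require Import boolp classical_sets functions reals.
From mathcomp Require Import (canonicals) mpoly.
(* Several of their names are shadowed by classical_sets. *)
From mathcomp Require Import fintype finset.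

Set Implicit Arguments.
Unset Strict Implicit.
Unset Printing Implicit Defensive.

Import Order.TTheory GRing.Theory Num.Theory.
Local Open Scope ring_scope.

(** * Matrices indexed by a finite type, and their support patterns *)

Section Entries.
Variables (R : nzRingType) (T : finType).
Implicit Types (A B : 'M[R]_#|T|) (i j : T).

Lemma eq_entry A B : (forall i j, entry A i j = entry B i j) -> A = B.
Proof.
move=> eAB; rewrite -[A]mx_of_entry -[B]mx_of_entry.
by apply/matrixP => a b; rewrite !mxE eAB.
Qed.

Lemma sum_enum_rank (S : nmodType) (F : 'I_#|T| -> S) :
  \sum_a F a = \sum_k F (enum_rank k).
Proof.
rewrite (reindex_onto (@enum_rank T) enum_val) /=; last by move=> a _; rewrite enum_valK.
by apply: eq_bigl => k; rewrite enum_rankK eqxx.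
Qed.

Lemma entryM A B i j : entry (A *m B) i j = \sum_k entry A i k * entry B k j.
Proof. by rewrite /entry mxE sum_enum_rank. Qed.

Lemma entry1 i j : entry (1%:M : 'M[R]_#|T|) i j = (i == j)%:R.
Proof. by rewrite /entry mxE (inj_eq enum_rank_inj). Qed.

Lemma entryT A i j : entry A^T i j = entry A j i.
Proof. by rewrite /entry mxE. Qed.

Lemma entryB A B i j : entry (A - B) i j = entry A i j - entry B i j.
Proof. by rewrite /entry !mxE. Qed.

Definition supported (e : rel T) A := forall i j, ~~ e i j -> entry A i j = 0.

(** A nonzero term of the product follows an [e1] step by an [e2] step. The quantifiers of the
    hypothesis are in the order of [transitive], so transitivity lemmas apply as they stand. *)
Lemma supportedM (e1 e2 e : rel T) A B :
    (forall j i k, e1 i j -> e2 j k -> e i k) ->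
  supported e1 A -> supported e2 B -> supported e (A *m B).
Proof.
move=> etr sA sB i j nij; rewrite entryM big1 // => k _.
have [eik|/sA ->] := boolP (e1 i k); last by rewrite mul0r.
by rewrite sB ?mulr0 //; apply: contraNN nij; apply: etr.
Qed.

Lemma supported1 (e : rel T) : reflexive e -> supported e 1%:M.
Proof.
by move=> er i j; rewrite entry1; case: eqP => // ->; rewrite er.
Qed.

Lemma supportedT (e : rel T) A :
  supported e A -> supported (fun i j => e j i) A^T.
Proof. by move=> sA i j nij; rewrite entryT sA. Qed.

Lemma supportedB (e : rel T) A B :
  supported e A -> supported e B -> supported e (A - B).
Proof. by move=> sA sB i j nij; rewrite entryB sA ?sB ?subr0. Qed.

Lemma sub_supported (e1 e2 : rel T) A :
  subrel e1 e2 -> supported e1 A -> supported e2 A.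
Proof. by move=> s12 sA i j nij; apply: sA; apply: contraNN nij; apply: s12. Qed.

Definition diag_mask (P : pred T) : 'M[R]_#|T| := mx_of (fun i j => ((i == j) && P i)%:R).

Lemma entry_maskl P A i j : entry (diag_mask P *m A) i j = if P i then entry A i j else 0.
Proof.
rewrite entryM (bigD1 i) //= big1 => [|k nki].
  by rewrite entry_mx_of eqxx addr0; case: (P i); rewrite ?mul1r ?mul0r.
by rewrite entry_mx_of eq_sym (negPf nki) mul0r.
Qed.

Lemma entry_maskr P A i j : entry (A *m diag_mask P) i j = if P j then entry A i j else 0.
Proof.
rewrite entryM (bigD1 j) //= big1 => [|k nki].
  by rewrite entry_mx_of eqxx addr0; case: (P j); rewrite ?mulr1 ?mulr0.
by rewrite entry_mx_of (negPf nki) mulr0.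
Qed.

End Entries.

(** * Block triangular matrices relative to a ranking *)

Section Patterns.
Variables (R : fieldType) (T : finType).
Implicit Types (A B : 'M[R]_#|T|) (i j : T).

(* The span of the unit vectors e_k with [e i k] is stable under an invertible
   matrix, hence under its inverse, by equality of dimensions. *)
Lemma supported_inv (e : rel T) A :
    reflexive e -> transitive e -> A \in unitmx ->
  supported e A -> supported e (invmx A).
Proof.
move=> er et uA sA i k nik.
pose U := diag_mask R (e i).
have UAU : U *m A = U *m A *m U.
  apply: eq_entry => u v; rewrite entry_maskr entry_maskl.
  case: ifP => // eiu; case: ifPn => // eiv; apply: sA.
  by apply: contraNN eiv; apply: et.
have sUA : (U *m A <= U)%MS by rewrite UAU submxMl.
have /submxP[Z UZ] : (U <= U *m A)%MS.
  by rewrite -(mxrank_leqif_sup sUA) mxrankMfree ?row_free_unit.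
have UiA : U *m invmx A = Z *m U by rewrite {1}UZ mulmxA mulmxK.
have := entry_maskl (e i) (invmx A) i k.
by rewrite -/U er UiA entry_maskr (negPf nik) => ->.
Qed.

Variable r : T -> nat.

(** The ranking [r] may have ties: the patterns are block triangular and block diagonal, with one
    block per value of [r]. *)
Definition upper A := supported (fun i j => r i <= r j)%N A.
Definition strictly_upper A := supported (fun i j => r i < r j)%N A.
Definition level_diag A := supported (fun i j => r i == r j) A.

Definition diag_part A : 'M[R]_#|T| :=
  mx_of (fun i j => if r i == r j then entry A i j else 0).

Lemma level_diag_diag_part A : level_diag (diag_part A).
Proof. by move=> i j nij; rewrite entry_mx_of (negPf nij). Qed.

Lemma strictly_upper_upper A : strictly_upper A -> upper A.
Proof. by apply: sub_supported => i j; apply: ltnW. Qed.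

Lemma level_diag_upper A : level_diag A -> upper A.
Proof. by apply: sub_supported => i j /eqP ->. Qed.

Lemma upper1 : upper 1%:M.
Proof. by apply: supported1. Qed.

Lemma upperM A B : upper A -> upper B -> upper (A *m B).
Proof. by apply: supportedM => j i k; apply: leq_trans. Qed.

Lemma upper_inv A : A \in unitmx -> upper A -> upper (invmx A).
Proof.
by apply: supported_inv => // j i k; apply: leq_trans.
Qed.

Lemma level_diagM A B : level_diag A -> level_diag B -> level_diag (A *m B).
Proof. by apply: supportedM => j i k /eqP ->. Qed.

Lemma level_diagT A : level_diag A -> level_diag A^T.
Proof.
by move/supportedT; apply: sub_supported => i j; rewrite eq_sym.
Qed.

Lemma level_diag_inv A : A \in unitmx -> level_diag A -> level_diag (invmx A).
Proof.
by apply: supported_inv => // j i k /eqP ->.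
Qed.

Lemma strictly_upperMdiag A B : strictly_upper A -> upper B -> strictly_upper (A *m B).
Proof. by apply: supportedM => j i k; apply: leq_trans. Qed.

Lemma strictly_upper_sub_diag_part A : upper A -> strictly_upper (A - diag_part A).
Proof.
move=> uA i j; rewrite -leqNgt leq_eqVlt entryB entry_mx_of eq_sym.
by case: eqP => [_|_ /=]; rewrite ?subrr // => lij; rewrite uA -?ltnNge ?subr0.
Qed.

(** For [r i = r j], a term through [k] survives only if [r i <= r k <= r j], so only the diagonal
    blocks contribute. *)
Lemma diag_partM A B : upper A -> upper B ->
  diag_part (A *m B) = diag_part A *m diag_part B.
Proof.
move=> uA uB; apply: eq_entry => i j; rewrite entry_mx_of !entryM.
case: ifPn => [/eqP rij|nij]; last first.
  rewrite big1 // => k _; rewrite !entry_mx_of.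
  case: (r i =P r k) => [<-|_]; last by rewrite mul0r.
  by rewrite (negPf nij) mulr0.
apply: eq_bigr => k _; rewrite !entry_mx_of -rij
  [X in if X then entry B _ _ else _]eq_sym.
case: eqP => // /eqP; rewrite neq_ltn => /orP[lik|lki].
  by rewrite (uB k j) ?mulr0 // -ltnNge -rij.
by rewrite (uA i k) ?mul0r // -ltnNge.
Qed.

Lemma diag_part1 : diag_part 1%:M = 1%:M.
Proof.
apply: eq_entry => i j; rewrite entry_mx_of entry1.
by case: (i =P j) => [->|_]; rewrite ?eqxx ?if_same.
Qed.

(** The inverse of an upper matrix is upper, so by multiplicativity its diagonal part inverts that
    of [A]. *)
Lemma diag_part_unit A : upper A -> A \in unitmx -> diag_part A \in unitmx.
Proof.
move=> uA iA; have /mulmx1_unit[] // : diag_part A *m diag_part (invmx A) = 1%:M.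
by rewrite -diag_partM ?mulmxV ?diag_part1 //; apply: upper_inv.
Qed.

Lemma unit_ker n (A : 'M[R]_n) :
  (forall x : 'rV_n, x *m A = 0 -> x = 0) -> A \in unitmx.
Proof.
move=> kA; rewrite -row_free_unit -kermx_eq0; apply/eqP/row_matrixP => i.
by rewrite row0; apply: kA; rewrite -row_mul mulmx_ker row0.
Qed.

Lemma col_mul m n p (j : 'I_p) (A : 'M[R]_(m, n)) (B : 'M_(n, p)) :
  col j (A *m B) = A *m col j B.
Proof. by rewrite !colE mulmxA. Qed.

Lemma entry_rowM (x : 'rV[R]_#|T|) A j :
  (x *m A) 0 (enum_rank j) = \sum_k x 0 (enum_rank k) * entry A k j.
Proof. by rewrite mxE sum_enum_rank. Qed.

Lemma eq_rV_entry (x y : 'rV[R]_#|T|) :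
  (forall i, x 0 (enum_rank i) = y 0 (enum_rank i)) -> x = y.
Proof.
move=> exy; apply/rowP => a; rewrite -[a]enum_valK; exact: exy.
Qed.

(** A row vector with x = x A vanishes by induction on the rank: its entry at [j] depends only on
    entries of smaller rank. *)
Lemma strictly_upper_unit A : strictly_upper A -> 1%:M - A \in unitmx.
Proof.
move=> sA; apply: unit_ker => x; rewrite mulmxBr mulmx1 => /eqP.
rewrite subr_eq0 => /eqP xA.
apply: eq_rV_entry => j; rewrite [RHS]mxE.
have [n] := ubnP (r j); elim: n j => // n IHn j rj.
rewrite xA entry_rowM big1 // => k _.
have [rkj|/sA ->] := boolP (r k < r j)%N; last by rewrite mulr0.
by rewrite IHn ?mul0r //; apply: leq_trans rkj _.
Qed.

(** Dividing by the diagonal part D turns the diagonal blocks into identities: I - M D^-1 = -(M - D)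
    D^-1. *)
Lemma strictly_upper_normalize M : upper M -> diag_part M \in unitmx ->
  strictly_upper (1%:M - M *m invmx (diag_part M)).
Proof.
move=> uM uD.
have -> : 1%:M - M *m invmx (diag_part M) =
    - ((M - diag_part M) *m invmx (diag_part M)).
  by rewrite mulmxBl mulmxV // opprB.
move=> i j nij; rewrite /entry mxE; apply/eqP; rewrite oppr_eq0; apply/eqP.
apply: (@strictly_upperMdiag (M - diag_part M)) nij.
  exact: strictly_upper_sub_diag_part.
apply: upper_inv => //; exact/level_diag_upper/level_diag_diag_part.
Qed.

Lemma upper_diag_part_unit M : upper M -> diag_part M \in unitmx -> M \in unitmx.
Proof.
move=> uM uD; have := strictly_upper_unit (strictly_upper_normalize uM uD).
by rewrite subKr unitmx_mul => /andP[].
Qed.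

Lemma upper1B A : strictly_upper A -> upper (1%:M - A).
Proof.
by move=> sA; apply: supportedB; [apply: upper1 | apply: strictly_upper_upper].
Qed.

End Patterns.

(** * Regression and the block triangular decomposition of a positive definite matrix *)

Section Regression.
Variables (R : realType) (T : finType) (r : T -> nat).
Implicit Types (A S W : 'M[R]_#|T|) (i j k : T) (x : 'rV[R]_#|T|).

Lemma PD_congr W M : PD R T W -> M \in unitmx -> PD R T (M^T *m W *m M).
Proof.
move=> [sW pW] uM; split; first by rewrite !trmx_mul trmxK sW mulmxA.
move=> x xN0; have uMT : M^T \in unitmx by rewrite unitmx_tr.
have -> : x *m (M^T *m W *m M) *m x^T = (x *m M^T) *m W *m (x *m M^T)^T.
  by rewrite trmx_mul trmxK !mulmxA.
by apply: pW; apply: contraNneq xN0 => xM0; rewrite -(mulmxK uMT x) xM0 mul0mx.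
Qed.

Lemma PD_phi L W : PD R T W -> 1%:M - L \in unitmx -> PD R T (phi (L, W)).
Proof. by move=> pW uL; apply: PD_congr; rewrite ?unitmx_inv. Qed.

Definition pre j : pred T := fun k => (r k < r j)%N.

(* Padding by the identity avoids submatrices whose size depends on [j]. *)
Definition pre_block S j : 'M[R]_#|T| :=
  diag_mask R (pre j) *m S *m diag_mask R (pre j) + (1%:M - diag_mask R (pre j)).

(* Column [j] holds the coefficients of the regression of [j] on [pre j] under
   the covariance matrix [S]. *)
Definition regression S : 'M[R]_#|T| :=
  mx_of (fun i j => entry (invmx (pre_block S j) *m diag_mask R (pre j) *m S) i j).

(** The covariance matrix of the regression errors, which is the factor D of the decomposition. *)
Definition residual S : 'M[R]_#|T| :=
  (1%:M - regression S)^T *m S *m (1%:M - regression S).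

Lemma mask_idem (P : pred T) : diag_mask R P *m diag_mask R P = diag_mask R P.
Proof.
by apply: eq_entry => i j; rewrite entry_maskl !entry_mx_of; case: (P i); rewrite ?andbF.
Qed.

Lemma mask_trmx (P : pred T) : (diag_mask R P)^T = diag_mask R P.
Proof.
apply: eq_entry => i j; rewrite entryT !entry_mx_of eq_sym.
by case: eqP => // ->.
Qed.

Lemma pre_block_maskr S j : pre_block S j *m diag_mask R (pre j) =
  diag_mask R (pre j) *m S *m diag_mask R (pre j).
Proof.
by rewrite mulmxDl mulmxBl mul1mx -(mulmxA _ (diag_mask R _)) mask_idem subrr addr0.
Qed.

Lemma pre_block_maskl S j : diag_mask R (pre j) *m pre_block S j =
  diag_mask R (pre j) *m S *m diag_mask R (pre j).
Proof. by rewrite mulmxDr mulmxBr mulmx1 !mulmxA mask_idem subrr addr0. Qed.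

(** If x K = 0 for the padded block K, the padding forces x = x P with P the mask; then x S x^T = x
    K P x^T = 0, so x = 0 by positive definiteness. *)
Lemma pre_block_unit S j : PD R T S -> pre_block S j \in unitmx.
Proof.
move=> [_ pS]; apply: unit_ker => x xK; set P := diag_mask R (pre j).
have xP : x *m P = x.
  have := congr1 (mulmx^~ (1%:M - P)) xK; rewrite mul0mx -mulmxA mulmxBr mulmx1.
  rewrite pre_block_maskr -/P /pre_block -/P addrAC subrr add0r => /eqP.
  by rewrite mulmxBr mulmx1 subr_eq0 => /eqP.
apply/eqP/negPn/negP => /pS; suff -> : x *m S *m x^T = 0 by rewrite mxE ltxx.
rewrite -{1 2}xP trmx_mul mask_trmx -/P.
have -> : x *m P *m S *m (P *m x^T) = x *m (P *m S *m P) *m x^T by rewrite !mulmxA.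
by rewrite -pre_block_maskr mulmxA xK !mul0mx.
Qed.

(** The padded block commutes with the mask, hence so does its inverse. *)
Lemma mask_pre_block_inv S j : PD R T S ->
  diag_mask R (pre j) *m invmx (pre_block S j) *m diag_mask R (pre j) =
  invmx (pre_block S j) *m diag_mask R (pre j).
Proof.
move=> pS; have uK := pre_block_unit j pS.
apply: (can_inj (mulKmx uK)); rewrite mulmxA.
rewrite [RHS]mulKVmx // mulmxA pre_block_maskr -pre_block_maskl.
by rewrite -(mulmxA (diag_mask _ _)) mulmxV // mulmx1 mask_idem.
Qed.

Lemma strictly_upper_regression S : PD R T S -> strictly_upper r (regression S).
Proof.
move=> pS i j nij; rewrite entry_mx_of -mask_pre_block_inv //.
by rewrite -!mulmxA entry_maskl /pre (negPf nij).
Qed.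

Lemma regression_unit S : PD R T S -> 1%:M - regression S \in unitmx.
Proof. by move/strictly_upper_regression/strictly_upper_unit. Qed.

(** The regression error of [j] is uncorrelated with every element of smaller rank. With P the mask
    and K the padded block, P S P = P K, hence P S (P K^-1 P S) = P S. *)
Lemma normal_equations S i j : PD R T S -> (r i < r j)%N ->
  entry (S *m (1%:M - regression S)) i j = 0.
Proof.
move=> pS rij; rewrite mulmxBr mulmx1 entryB.
apply/eqP; rewrite subr_eq0 eq_sym; apply/eqP.
pose P := diag_mask R (pre j); pose B := invmx (pre_block S j) *m P *m S.
have -> : entry (S *m regression S) i j = entry (S *m B) i j.
  rewrite !entryM; apply: eq_bigr => k _.
  by rewrite [entry (regression S) _ _]entry_mx_of.
have entP M : entry M i j = entry (P *m M) i j by rewrite entry_maskl /pre rij.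
rewrite entP [RHS]entP /B -mask_pre_block_inv // -/P.
have -> : P *m (S *m (P *m invmx (pre_block S j) *m P *m S)) =
   P *m S *m P *m invmx (pre_block S j) *m P *m S by rewrite !mulmxA.
rewrite -[P *m S *m P]pre_block_maskl -(mulmxA P).
by rewrite mulmxV ?pre_block_unit // mulmx1 mask_idem.
Qed.

(** Above the diagonal blocks, the lower triangular factor (I - A)^T only meets entries of S (I - A)
    killed by the normal equations; symmetry gives the entries below. *)
Lemma level_diag_residual S : PD R T S -> level_diag r (residual S).
Proof.
move=> pS; have up := upper1B (strictly_upper_regression pS).
have low i j : (r i < r j)%N -> entry (residual S) i j = 0.
  move=> rij; rewrite /residual -mulmxA entryM big1 // => k _; rewrite entryT.
  have [lki|/up ->] := boolP (r k <= r i)%N; last by rewrite mul0r.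
  by rewrite normal_equations ?mulr0 //; apply: leq_ltn_trans rij.
move=> i j; rewrite neq_ltn => /orP[/low //|/low <-]; rewrite -entryT.
by rewrite /residual !trmx_mul trmxK (proj1 pS) mulmxA.
Qed.

Lemma PD_residual S : PD R T S -> PD R T (residual S).
Proof. by move=> pS; apply: PD_congr => //; apply: regression_unit. Qed.

(** With D the block diagonal matrix, S (I - A) = (I - A)^-T D is block lower triangular, so [A]
    satisfies the normal equations. These determine each column, because the padded block is
    invertible. *)
Lemma regression_unique S A : PD R T S -> strictly_upper r A ->
  level_diag r ((1%:M - A)^T *m S *m (1%:M - A)) -> regression S = A.
Proof.
move=> pS sA; set D := _ *m (_ - _); move=> lD.
have uA : (1%:M - A)^T \in unitmx by rewrite unitmx_tr (strictly_upper_unit sA).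
have SA : S *m (1%:M - A) = (invmx (1%:M - A))^T *m D.
  by rewrite /D trmx_inv -mulmxA mulKmx.
have eqn i j : (r i < r j)%N -> entry (S *m A) i j = entry S i j.
  move=> rij; apply/eqP; rewrite eq_sym -subr_eq0 -entryB -{1}[S]mulmx1 -mulmxBr SA.
  rewrite entryM big1 // => k _; rewrite entryT.
  have [/eqP rkj|/lD ->] := boolP (r k == r j); last by rewrite mulr0.
  rewrite (@upper_inv _ _ r (1%:M - A)) ?mul0r -?ltnNge ?rkj //.
    exact: strictly_upper_unit sA.
  exact: upper1B.
apply: eq_entry => i j; rewrite entry_mx_of /entry.
set P := diag_mask R (pre j); set c := enum_rank j.
(* Column [c] of [A] is fixed by [P], so the normal equations become a linear system with matrix
   [pre_block S j]. *)
suff E : P *m col c S = pre_block S j *m col c A.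
  have <- : col c (invmx (pre_block S j) *m P *m S) (enum_rank i) 0 = A (enum_rank i) c.
    by rewrite col_mul -mulmxA E mulKmx ?pre_block_unit // mxE.
  by rewrite [RHS]mxE.
have eq_col M N : (forall k, entry M k j = entry N k j) -> col c M = col c N.
  move=> eMN; apply/colP => a; rewrite [LHS]mxE [RHS]mxE -(enum_valK a); exact: eMN.
have PA : P *m col c A = col c A.
  rewrite -col_mul; apply: eq_col => k; rewrite entry_maskl.
  by case: ifPn => // /sA.
rewrite -[in RHS]PA mulmxA pre_block_maskr -/P -(mulmxA _ P) PA -mulmxA -!col_mul.
by apply: eq_col => k; rewrite !entry_maskl; case: ifP => // /eqn.
Qed.

End Regression.

(** * The decomposition of [phi (L, W)] read off from a change of basis *)

Section Transfer.
Variables (R : realType) (T : finType) (r : T -> nat).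
Variables (L W X : 'M[R]_#|T|).
Hypotheses (pW : PD R T W) (uL : 1%:M - L \in unitmx) (uX : X \in unitmx).
Hypothesis upX : strictly_upper r (1%:M - (1%:M - L) *m X).
Hypothesis diX : level_diag r (X^T *m W *m X).

Lemma residual_phiE :
  ((1%:M - L) *m X)^T *m phi (L, W) *m ((1%:M - L) *m X) = X^T *m W *m X.
Proof.
rewrite /phi /= trmx_mul !mulmxA mulmxKV // -!mulmxA; congr (_ *m _).
by rewrite !mulmxA -trmx_mul mulVmx // trmx1 mul1mx.
Qed.

Lemma regression_phi : regression r (phi (L, W)) = 1%:M - (1%:M - L) *m X.
Proof.
apply: regression_unique => //; first exact: PD_phi.
by rewrite subKr residual_phiE.
Qed.

Lemma residual_phi : residual r (phi (L, W)) = X^T *m W *m X.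
Proof. by rewrite /residual regression_phi subKr residual_phiE. Qed.

Lemma phi_regression_residual :
  phi (1%:M - (1%:M - L) *m X, X^T *m W *m X) = phi (L, W).
Proof.
have uLX : (1%:M - L) *m X \in unitmx by rewrite unitmx_mul uL.
rewrite -residual_phiE; move: (phi (L, W)) uLX; move: (_ *m X) => M S uM.
rewrite /phi /= subKr !mulmxA mulmxK // -trmx_mul.
by rewrite mulmxV // trmx1 mul1mx.
Qed.

End Transfer.

(** * Levels and mixed classes of vertices *)

Section Graph.
Variables (V : finType) (G : mixed_graph V).
Implicit Types (i j k : V) (C : comp_index G).

(* Monotone along directed edges, and constant along an edge only inside a
   strong component: the levels replace a topological order of the strong
   components. *)
Definition level i : nat := #|[pred k | connect (dir G) k i]|.

Lemma level_dir i j : dir G i j -> (level i <= level j)%N.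
Proof.
move=> ij; apply/subset_leq_card/subsetP => k; rewrite !inE => ki.
exact: connect_trans ki (connect1 ij).
Qed.

(** Along an edge the set of ancestors grows; equal cardinalities make both sets equal, and [j] is
    an ancestor of itself. *)
Lemma connect_level_eq i j : dir G i j -> level i = level j -> connect (dir G) j i.
Proof.
move=> ij eij.
have sij : [pred k | connect (dir G) k i] \subset [pred k | connect (dir G) k j].
  by apply/subsetP => k; rewrite !inE => ki; apply: connect_trans ki (connect1 ij).
have /subset_cardP/(_ sij)/(_ j) := eij.
by rewrite !inE connect0.
Qed.

Lemma strong_equivalence :
  {in [set: V]%SET & &, equivalence_rel
    (fun i j => connect (dir G) i j && connect (dir G) j i)}.
Proof.
move=> x y z _ _ _ /=; rewrite connect0; split=> // /andP[xy yx].
apply/andP/andP => -[a b]; split;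
  by [apply: connect_trans a | apply: connect_trans b _].
Qed.

Lemma bidirected_equivalence :
  {in [set: V]%SET & &, equivalence_rel (connect (bidir G))}.
Proof.
move=> x y z _ _ _; rewrite connect0; split=> // xy.
exact: (same_connect (sym_connect_sym (@bidir_sym _ G))).
Qed.

Lemma mixed_partitionP :
  [/\ partition (mixed_partition G) [set: V]%SET,
      coarser (bidirected_components G) (mixed_partition G)
    & coarser (strong_components G) (mixed_partition G)].
Proof.
by have [] := common_coarseningP (equivalence_partitionP bidirected_equivalence)
  (equivalence_partitionP strong_equivalence).
Qed.

Lemma cover_mixed_partition : cover (mixed_partition G) = [set: V]%SET.
Proof. by have [/and3P[/eqP]] := mixed_partitionP. Qed.

Lemma pblock_mixed_partition i : pblock (mixed_partition G) i \in mixed_partition G.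
Proof. by rewrite pblock_mem // cover_mixed_partition inE. Qed.

Definition class i : comp_index G :=
  exist (fun C : {set V} => C \in mixed_partition G) _ (pblock_mixed_partition i).

Lemma mem_class i C : (i \in val C) = (class i == C).
Proof.
have [/and3P[_ tP _] _ _] := mixed_partitionP; apply/idP/eqP => [iC|<-].
  by apply: val_inj; apply: def_pblock => //; apply: valP.
by rewrite /= mem_pblock cover_mixed_partition inE.
Qed.

Lemma class_coarser (e : rel V) i j :
    {in [set: V]%SET & &, equivalence_rel e} ->
    coarser (equivalence_partition e [set: V]%SET) (mixed_partition G) ->
  e i j -> class i = class j.
Proof.
set Q := equivalence_partition _ _ => eqv /forall_inP cQ eij.
have /and3P[/eqP cP _ _] : partition Q [set: V]%SET by apply: equivalence_partitionP.
have /cQ/exists_inP[B BJ /subsetP sB] : pblock Q i \in Q.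
  by rewrite pblock_mem // cP inE.
have classB k : k \in pblock Q i ->
    class k = exist (fun C : {set V} => C \in mixed_partition G) B BJ.
  by move=> /sB kB; apply/eqP; rewrite -mem_class.
rewrite !classB ?mem_pblock ?cP ?inE //.
by rewrite (pblock_equivalence_partition eqv) ?inE.
Qed.

Lemma class_bidir i j : bidir G i j -> class i = class j.
Proof.
have [_ cB _] := mixed_partitionP => ij.
exact: class_coarser bidirected_equivalence cB (connect1 ij).
Qed.

Lemma class_level i j : dir G i j -> level i = level j -> class i = class j.
Proof.
have [_ _ cS] := mixed_partitionP => ij eij.
apply: class_coarser strong_equivalence cS _.
by rewrite (connect_level_eq ij eij) connect1.
Qed.

Lemma mem_vset i C : i \in val C -> i \in vset G (val C).
Proof. by move=> iC; rewrite inE iC. Qed.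

Lemma dir_vset i j : dir G i j -> i \in vset G (val (class j)).
Proof.
move=> ij; rewrite inE; apply/orP; right; apply/bigcupP; exists j; rewrite ?inE //.
by rewrite mem_class.
Qed.

End Graph.

(** * Restriction to a mixed component *)

Section Components.
Variables (R : realType) (V : finType) (G : mixed_graph V).
Implicit Types (i j k : V) (C : comp_index G) (M L W X : 'M[R]_#|V|).

Definition class_diag M := supported (fun i j => class G i == class G j) M.

Lemma class_diagT M : class_diag M -> class_diag M^T.
Proof. by move/supportedT; apply: sub_supported => i j; rewrite eq_sym. Qed.

Lemma class_diagM M N : class_diag M -> class_diag N -> class_diag (M *m N).
Proof. by apply: supportedM => j i k /eqP ->. Qed.

Lemma class_diag_inv M : M \in unitmx -> class_diag M -> class_diag (invmx M).
Proof. by apply: supported_inv => // j i k /eqP ->. Qed.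

Lemma not_class C i j : i \in val C -> j \notin val C -> class G i != class G j.
Proof. by rewrite !mem_class => /eqP ->; rewrite eq_sym. Qed.

Lemma sum_vcomp C (F : V -> R) : (forall k, k \notin val C -> F k = 0) ->
  \sum_k F k = \sum_(k : vcomp C) F (val k).
Proof.
move=> F0; rewrite -(big_sub (mem (vset G (val C)))).
rewrite [LHS](bigID (mem (vset G (val C)))) /=.
rewrite [X in _ + X]big1 ?addr0 // => k nk; apply: F0.
by apply: contraNN nk; apply: mem_vset.
Qed.

(** Padding by columns of the identity lets one formula cover both I - [pi_dir C L] and, for
    class-diagonal [W], [pi_bidir C W]. *)
Definition restrict C M : 'M[R]_#|vcomp C| :=
  mx_of (fun i j : vcomp C =>
    if val j \in val C then entry M (val i) (val j) else (i == j)%:R).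

Lemma restrict_1B C L : restrict C (1%:M - L) = 1%:M - pi_dir C L.
Proof.
apply: eq_entry => i j; rewrite entryB entry1 !entry_mx_of.
by case: ifP; rewrite ?subr0 // entryB entry1 (inj_eq val_inj).
Qed.

Lemma restrict1 C : restrict C 1%:M = 1%:M.
Proof.
apply: eq_entry => i j; rewrite entry_mx_of !entry1.
by rewrite (inj_eq val_inj) if_same.
Qed.

Lemma restrict_bidir C W : class_diag W -> pi_bidir C W = restrict C W.
Proof.
move=> dW; apply: eq_entry => i j; rewrite !entry_mx_of.
have [iC|niC] := boolP (val i \in val C); have [jC|njC] := boolP (val j \in val C) => //=.
- by rewrite andbF; case: eqP njC iC => // -> /negPf ->.
- rewrite andbT dW; last by rewrite eq_sym (not_class jC).
  by case: eqP niC jC => // -> /negPf ->.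
- by rewrite andbT; case: eqP.
Qed.

(** For [j] in [C], column [j] of [X] lives on [C], so the sum over V[C] loses nothing; for other
    [j], both restricted factors have a unit vector as column [j]. *)
Lemma restrictM C M X : class_diag X ->
  restrict C (M *m X) = restrict C M *m restrict C X.
Proof.
move=> dX; apply: eq_entry => i j; rewrite entryM entry_mx_of entryM.
have [jC|njC] := boolP (val j \in val C).
  have F0 k : k \notin val C -> entry M (val i) k * entry X k (val j) = 0.
    by move=> nk; rewrite dX ?mulr0 // eq_sym (not_class jC).
  rewrite (sum_vcomp F0); apply: eq_bigr => k _; rewrite !entry_mx_of jC.
  by case: ifPn => // nk; rewrite F0 // dX ?mulr0 // eq_sym (not_class jC).
rewrite (bigD1 j) //= big1 ?addr0 => [|k nkj]; rewrite !entry_mx_of (negPf njC).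
  by rewrite eqxx mulr1.
by rewrite (negPf nkj) mulr0.
Qed.

Lemma restrictT C X : class_diag X -> restrict C X^T = (restrict C X)^T.
Proof.
move=> dX; apply: eq_entry => i j; rewrite entryT !entry_mx_of entryT.
have [jC|njC] := boolP (val j \in val C); have [iC|niC] := boolP (val i \in val C) => //.
- by rewrite dX ?(not_class jC) //; case: eqP niC => // <-; rewrite jC.
- rewrite dX; last by rewrite eq_sym (not_class iC).
  by case: eqP njC => // <-; rewrite iC.
- by rewrite eq_sym.
Qed.

Lemma restrict_unit C X : class_diag X -> X \in unitmx -> restrict C X \in unitmx.
Proof.
move=> dX uX; have /mulmx1_unit[] // : restrict C X *m restrict C (invmx X) = 1%:M.
by rewrite -restrictM ?mulmxV ?restrict1 //; apply: class_diag_inv.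
Qed.

(** The level is that of [G], not of the component: with a common ranking, restriction respects the
    triangular patterns and the diagonal parts. *)
Definition clevel C (a : vcomp C) : nat := level G (val a).

Lemma strictly_upper_pi_dir C L :
  strictly_upper (level G) L -> strictly_upper (clevel (C:=C)) (pi_dir C L).
Proof. by move=> uL i j nij; rewrite entry_mx_of; case: ifP => // _; apply: uL. Qed.

Lemma level_diag_pi_bidir C W :
  level_diag (level G) W -> level_diag (clevel (C:=C)) (pi_bidir C W).
Proof.
move=> dW i j nij; rewrite entry_mx_of dW //.
by case: (i =P j) nij => [->|_ _ /=]; rewrite ?eqxx ?if_same.
Qed.

Lemma upper_restrict C M : upper (level G) M -> upper (clevel (C:=C)) (restrict C M).
Proof.
move=> uM i j nij; rewrite entry_mx_of uM //.
by case: eqP nij => [->|]; rewrite ?leqnn ?if_same.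
Qed.

Lemma diag_part_restrict C M :
  diag_part (clevel (C:=C)) (restrict C M) = restrict C (diag_part (level G) M).
Proof.
apply: eq_entry => i j; rewrite !entry_mx_of.
case: (i =P j) => [->|_]; first by rewrite eqxx.
by do 2 case: ifP.
Qed.

Lemma upper_RD L : RD G L -> upper (level G) (1%:M - L).
Proof.
move=> sL; apply: supportedB; first exact: upper1.
by apply: sub_supported sL => i j; apply: level_dir.
Qed.

(** An edge inside a level joins two vertices of one strong component. Hence the diagonal blocks
    split along the classes, although a level may meet several classes. *)
Lemma class_diag_diag_part L : RD G L -> class_diag (diag_part (level G) (1%:M - L)).
Proof.
move=> sL i j nij; rewrite entry_mx_of; case: eqP => // lij.
rewrite entryB entry1 sL; last by apply: contraNN nij => /class_level/(_ lij) ->.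
by case: (i =P j) nij => [->|_ _]; rewrite ?eqxx ?subr0.
Qed.

(** Invertibility is decided on the diagonal part, in V and in each V[C]. That part is
    class-diagonal, so it can be tested component by component. *)
Lemma restrict_unitP L : RD G L ->
  1%:M - L \in unitmx <-> forall C, restrict C (1%:M - L) \in unitmx.
Proof.
move=> sL; set M := 1%:M - L; have uM := upper_RD sL.
set D := diag_part (level G) M; have dD : class_diag D by apply: class_diag_diag_part.
split=> [iM C|iM].
  apply: (upper_diag_part_unit (upper_restrict uM)).
  rewrite diag_part_restrict; apply: restrict_unit => //.
  exact: diag_part_unit.
apply: (upper_diag_part_unit uM); apply: unit_ker => x xD.
apply: eq_rV_entry => i; rewrite [RHS]mxE.
pose C := class G i; have iC : i \in val C by rewrite mem_class.
(* The part of [x] on [C], extended by zero to V[C]. *)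
pose y : 'rV_#|vcomp C| :=
  \row_a (if val (enum_val a) \in val C then x 0 (enum_rank (val (enum_val a))) else 0).
have yE (k : vcomp C) : y 0 (enum_rank k) =
    if val k \in val C then x 0 (enum_rank (val k)) else 0.
  by rewrite mxE enum_rankK.
have uD : restrict C D \in unitmx.
  by rewrite -diag_part_restrict; apply: diag_part_unit (iM C); apply: upper_restrict.
suff yD : y *m restrict C D = 0.
  have y0 : y = 0 by rewrite -(mulmxK uD y) yD mul0mx.
  by have := yE (exist _ i (mem_vset iC)); rewrite /= iC y0 mxE => <-.
apply: eq_rV_entry => j; rewrite entry_rowM [RHS]mxE.
have [jC|njC] := boolP (val j \in val C).
  transitivity ((x *m D) 0 (enum_rank (val j))); last by rewrite xD mxE.
  rewrite entry_rowM (sum_vcomp (C:=C)) => [|k nk].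
    apply: eq_bigr => k _; rewrite yE entry_mx_of jC; case: ifPn => // nk.
    by rewrite mul0r dD ?mulr0 // eq_sym (not_class jC).
  by rewrite dD ?mulr0 // eq_sym (not_class jC).
rewrite big1 // => k _; rewrite yE entry_mx_of (negPf njC).
by case: (k =P j) => [->|_]; rewrite ?(negPf njC) ?mul0r ?mulr0.
Qed.

End Components.

(** * Gluing component matrices, and positive definiteness *)

Section Glue.
Variables (R : realType) (V : finType) (G : mixed_graph V).
Implicit Types (i j k : V) (C : comp_index G) (M L W X : 'M[R]_#|V|).
Implicit Types q : comp_mx R G.

(** The default 0 is right in a column of [C]: all parents of a vertex of [C] lie in V[C]. *)
Definition extend C (N : 'M[R]_#|vcomp C|) i j : R :=
  match insub i, insub j with
  | Some i', Some j' => entry N (i' : vcomp C) (j' : vcomp C)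
  | _, _ => 0
  end.

Lemma extend_val C (N : 'M[R]_#|vcomp C|) (i j : vcomp C) :
  extend N (val i) (val j) = entry N i j.
Proof. by rewrite /extend !valK. Qed.

Lemma extend_eq0 C (N : 'M[R]_#|vcomp C|) i j :
    (forall i' j' : vcomp C, val i' = i -> val j' = j -> entry N i' j' = 0) ->
  extend N i j = 0.
Proof.
move=> N0; rewrite /extend; case: insubP => // i' _ ei; case: insubP => // j' _ ej.
exact: N0.
Qed.

Definition glue_dir q : 'M[R]_#|V| := mx_of (fun i j => extend (q (class G j)) i j).

Definition glue_bidir q : 'M[R]_#|V| :=
  mx_of (fun i j => if class G i == class G j then extend (q (class G j)) i j else 0).

(** The partial identity between V and V[C] supported on [C]. It expresses [pi_bidir] and
    [glue_bidir] by congruences, which gives access to quadratic forms. *)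
Definition inclusion C : 'M[R]_(#|V|, #|vcomp C|) :=
  \matrix_(a, b) ((enum_val a == val (enum_val b)) && (enum_val a \in val C))%:R.

Lemma row_inclusion C (x : 'rV[R]_#|V|) (k : vcomp C) :
  (x *m inclusion C) 0 (enum_rank k) =
  if val k \in val C then x 0 (enum_rank (val k)) else 0.
Proof.
rewrite mxE sum_enum_rank (bigD1 (val k)) //= big1 ?addr0 => [|i nik].
  by rewrite mxE !enum_rankK eqxx /=; case: ifP; rewrite ?mulr1 ?mulr0.
by rewrite mxE !enum_rankK (negPf nik) mulr0.
Qed.

Lemma row_inclusionT C (z : 'rV[R]_#|vcomp C|) (k : vcomp C) : val k \in val C ->
  (z *m (inclusion C)^T) 0 (enum_rank (val k)) = z 0 (enum_rank k).
Proof.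
move=> kC; rewrite mxE sum_enum_rank (bigD1 k) //= big1 ?addr0 => [|i nik].
  by rewrite !mxE !enum_rankK eqxx kC mulr1.
by rewrite !mxE !enum_rankK (inj_eq val_inj) eq_sym (negPf nik) mulr0.
Qed.

Lemma sandwich m n (E : 'M[R]_(m, n)) N a b :
  (E *m N *m E^T) a b = (row a E *m N *m (row b E)^T) 0 0.
Proof.
rewrite -row_mul tr_row mxE [RHS]mxE.
by apply: eq_bigr => c _; rewrite !mxE.
Qed.

Lemma sandwich_delta m n (E : 'M[R]_(m, n)) N a b a' b' :
    row a E = delta_mx 0 a' -> row b E = delta_mx 0 b' ->
  (E *m N *m E^T) a b = N a' b'.
Proof.
move=> Ea Eb; rewrite sandwich Ea Eb -rowE trmx_delta -colE.
by rewrite !mxE.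
Qed.

Lemma sandwich0l m n (E : 'M[R]_(m, n)) N a b :
  row a E = 0 -> (E *m N *m E^T) a b = 0.
Proof. by move=> Ea; rewrite sandwich Ea !mul0mx mxE. Qed.

Lemma sandwich0r m n (E : 'M[R]_(m, n)) N a b :
  row b E = 0 -> (E *m N *m E^T) a b = 0.
Proof. by move=> Eb; rewrite sandwich Eb trmx0 mulmx0 mxE. Qed.

Lemma row_inclusion_in C (k : vcomp C) : val k \in val C ->
  row (enum_rank (val k)) (inclusion C) = delta_mx 0 (enum_rank k).
Proof.
move=> kC; apply: eq_rV_entry => l; rewrite !mxE !enum_rankK kC andbT eqxx /=.
by rewrite (inj_eq val_inj) (inj_eq enum_rank_inj) eq_sym.
Qed.

Lemma row_inclusion_notin C i : i \notin val C ->
  row (enum_rank i) (inclusion C) = 0.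
Proof.
move=> iC; apply: eq_rV_entry => l; rewrite !mxE enum_rankK (negPf iC).
by rewrite andbF.
Qed.

Lemma row_inclusionT_in C (k : vcomp C) : val k \in val C ->
  row (enum_rank k) (inclusion C)^T = delta_mx 0 (enum_rank (val k)).
Proof.
move=> kC; apply: eq_rV_entry => l; rewrite !mxE !enum_rankK eqxx /=.
by rewrite (inj_eq enum_rank_inj); case: eqP => //= ->; rewrite kC.
Qed.

Lemma row_inclusionT_notin C (k : vcomp C) : val k \notin val C ->
  row (enum_rank k) (inclusion C)^T = 0.
Proof.
move=> kC; apply: eq_rV_entry => l; rewrite !mxE !enum_rankK.
by case: eqP => //= ->; rewrite (negPf kC).
Qed.

Lemma pi_bidirE C W : pi_bidir C W =
  (inclusion C)^T *m W *m inclusion C +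
  diag_mask R (fun k : vcomp C => val k \notin val C).
Proof.
apply: eq_entry => i j; rewrite entry_mx_of -{2}[inclusion C]trmxK.
rewrite [RHS]mxE -/(entry (diag_mask _ _) i j) entry_mx_of.
have [iC|iC] := boolP (val i \in val C); last first.
  by rewrite sandwich0l ?row_inclusionT_notin // add0r; case: (i == j).
have [jC|jC] := boolP (val j \in val C); last first.
  by rewrite sandwich0r ?row_inclusionT_notin //= !andbF add0r.
rewrite (sandwich_delta _ (row_inclusionT_in iC) (row_inclusionT_in jC)).
by rewrite andbF addr0.
Qed.

Lemma entry_glue_component C (N : 'M[R]_#|vcomp C|) i j :
  (inclusion C *m N *m (inclusion C)^T) (enum_rank i) (enum_rank j) =
  if (i \in val C) && (j \in val C) then extend N i j else 0.
Proof.
have [iC|iC] := boolP (i \in val C); last by rewrite sandwich0l ?row_inclusion_notin.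
have [jC|jC] := boolP (j \in val C); last by rewrite sandwich0r ?row_inclusion_notin.
pose i' : vcomp C := exist _ i (mem_vset iC).
pose j' : vcomp C := exist _ j (mem_vset jC).
rewrite (extend_val N i' j' : extend N i j = _).
exact: (@sandwich_delta _ _ _ N _ _ _ _
  (@row_inclusion_in C i' iC) (@row_inclusion_in C j' jC)).
Qed.

Lemma glue_bidirE q :
  glue_bidir q = \sum_C inclusion C *m q C *m (inclusion C)^T.
Proof.
apply: eq_entry => i j; rewrite entry_mx_of {1}/entry summxE.
rewrite (bigD1 (class G j)) //= big1 ?addr0 => [|C nC].
  by rewrite entry_glue_component !mem_class eqxx andbT.
by rewrite entry_glue_component !mem_class eq_sym [_ == C]eq_sym (negPf nC) andbF.
Qed.

(** The quadratic form is that of [W] at z E^T plus the squares of the coordinates outside [C]. The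
    first term is positive unless z vanishes on [C], and then the second one is. *)
Lemma PD_pi_bidir C W : PD R V W -> PD R (vcomp C) (pi_bidir C W).
Proof.
move=> [sW pW]; rewrite pi_bidirE; set E := inclusion C; set P := diag_mask R _.
split; first by rewrite raddfD /= !trmx_mul trmxK sW mulmxA mask_trmx.
move=> z zN0; rewrite mulmxDr mulmxDl mxE.
have -> : z *m (E^T *m W *m E) *m z^T = (z *m E^T) *m W *m (z *m E^T)^T.
  by rewrite trmx_mul trmxK !mulmxA.
have zP (k : vcomp C) : (z *m P) 0 (enum_rank k) =
    if val k \notin val C then z 0 (enum_rank k) else 0.
  rewrite entry_rowM (bigD1 k) //= big1 ?addr0 => [|i nik]; rewrite entry_mx_of.
    by rewrite eqxx /=; case: (_ \in _); rewrite ?mulr0 ?mulr1.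
  by rewrite (negPf nik) mulr0.
have zPz : (z *m P *m z^T) 0 0 = \sum_k ((z *m P) 0 (enum_rank k)) ^+ 2.
  rewrite mxE sum_enum_rank; apply: eq_bigr => k _; rewrite zP [z^T _ _]mxE.
  by case: ifP; rewrite ?mul0r ?expr0n.
have zPz0 : 0 <= (z *m P *m z^T) 0 0 by rewrite zPz sumr_ge0 // => k _; apply: sqr_ge0.
have [zE0|/pW zE] := eqVneq (z *m E^T) 0; last exact: ltr_wpDr.
rewrite zE0 !mul0mx mxE add0r lt0r zPz0 andbT zPz.
rewrite psumr_eq0 => [|k _]; last exact: sqr_ge0.
apply: contra_neqN zN0 => /allP z0; apply: eq_rV_entry => k; rewrite [RHS]mxE.
have [kC|kC] := boolP (val k \in val C).
  by rewrite -(row_inclusionT z kC) zE0 mxE.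
by have := z0 k (mem_index_enum _); rewrite sqrf_eq0 zP kC => /eqP.
Qed.

(** The form at x is the sum over C of the forms of [q C] at the part of x on C. It vanishes only if
    every part does, and the classes cover V. *)
Lemma PD_glue_bidir q : (forall C, PD R (vcomp C) (q C)) -> PD R V (glue_bidir q).
Proof.
move=> pq; rewrite glue_bidirE; split.
  rewrite raddf_sum; apply: eq_bigr => C _ /=.
  by rewrite !trmx_mul trmxK (proj1 (pq C)) mulmxA.
move=> x xN0; rewrite mulmx_sumr mulmx_suml summxE.
pose y C := x *m inclusion C.
have -> : \sum_C (x *m (inclusion C *m q C *m (inclusion C)^T) *m x^T) 0 0 =
    \sum_C (y C *m q C *m (y C)^T) 0 0.
  by apply: eq_bigr => C _; rewrite /y trmx_mul !mulmxA.
have y_ge0 C : 0 <= (y C *m q C *m (y C)^T) 0 0.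
  have [->|/(proj2 (pq C))/ltW //] := eqVneq (y C) 0.
  by rewrite !mul0mx mxE.
rewrite lt0r sumr_ge0 ?andbT // psumr_eq0 //.
apply: contra_neqN xN0 => /allP y0; apply: eq_rV_entry => i; rewrite [RHS]mxE.
pose C := class G i; have iC : i \in val C by rewrite mem_class.
have yC0 : y C = 0.
  have := y0 C (mem_index_enum _); apply: contraTeq => /(proj2 (pq C)).
  by rewrite lt0r => /andP[].
have := row_inclusion x (exist _ i (mem_vset iC) : vcomp C).
by rewrite /= iC -/(y C) yC0 mxE.
Qed.

Lemma pi_dir_glue q C :
    (forall i j : vcomp C, val j \notin val C -> entry (q C) i j = 0) ->
  pi_dir C (glue_dir q) = q C.
Proof.
move=> q0; apply: eq_entry => i j; rewrite entry_mx_of.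
have [jC|/q0 -> //] := boolP (val j \in val C).
move: (jC); rewrite mem_class => /eqP eC.
rewrite entry_mx_of; move: (class G _) eC => C' eC.
by rewrite eC extend_val.
Qed.

(** Column [j] is only asked to live on V[C] for the class C of [j]. This covers [RD], but also the
    regression matrix of [phi (L, W)], which may have nonzero entries off the directed edges. *)
Lemma glue_pi_dir L :
    (forall i j, i \notin vset G (val (class G j)) -> entry L i j = 0) ->
  glue_dir (fun C => pi_dir C L) = L.
Proof.
move=> L0; apply: eq_entry => i j; rewrite entry_mx_of.
set C := class G j; have jC : j \in val C by rewrite mem_class.
have [iC|iC] := boolP (i \in vset G (val C)); last first.
  by rewrite /extend insubN // L0.
rewrite (extend_val (pi_dir C L) (exist _ i iC) (exist _ j (mem_vset jC))).
by rewrite entry_mx_of /= jC.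
Qed.

Lemma glue_pi_bidir W : class_diag G W -> glue_bidir (fun C => pi_bidir C W) = W.
Proof.
move=> dW; apply: eq_entry => i j; rewrite entry_mx_of.
case: ifPn => [/eqP eij|/dW //].
have jC : j \in val (class G j) by rewrite mem_class.
have iC : i \in val (class G j) by rewrite mem_class eij.
rewrite (extend_val (pi_bidir _ W) (exist _ i (mem_vset iC)) (exist _ j (mem_vset jC))).
by rewrite entry_mx_of /= iC jC.
Qed.

Lemma pi_bidir_glue q C :
    (forall i j : vcomp C, ~~ ((val i \in val C) && (val j \in val C)) ->
       entry (q C) i j = ((i == j) && (val i \notin val C))%:R) ->
  pi_bidir C (glue_bidir q) = q C.
Proof.
move=> q0; apply: eq_entry => i j; rewrite entry_mx_of.
case: ifPn => [/andP[iC jC]|/q0 ->]; last by case: (_ && _).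
move: iC jC; rewrite !mem_class entry_mx_of => /eqP -> /eqP eC.
rewrite eC eqxx; exact: extend_val.
Qed.

End Glue.

(** * The bijection [pi_map], the maps [tau] and [tau_inv], and their compatibility with [phi] *)

Section Decomposition.
Variables (R : realType) (V : finType) (G : mixed_graph V).
Implicit Types (i j : V) (C : comp_index G) (L W X S : 'M[R]_#|V|).

Lemma class_diag_PDB W : PDB G W -> class_diag G W.
Proof.
move=> [_ bW] i j nij; apply: bW; first by apply: contraNneq nij => ->.
by apply: contraNN nij => /class_bidir ->.
Qed.

Lemma class_diag_mask (P : pred V) : class_diag G (diag_mask R P).
Proof.
by move=> i j nij; rewrite entry_mx_of; case: (i =P j) nij => [->|]; rewrite ?eqxx.
Qed.

Lemma class_diag1 : class_diag G (1%:M : 'M[R]_#|V|).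
Proof. exact: supported1. Qed.

(** Regression is built from masks, sums, products and inverses, all of which preserve
    class-diagonality. *)
Lemma class_diag_regression (r : V -> nat) W :
  PD R V W -> class_diag G W -> class_diag G (regression r W).
Proof.
move=> pW dW i j nij; rewrite entry_mx_of; apply: class_diagM nij => //.
apply: class_diagM; last exact: class_diag_mask.
apply: class_diag_inv; first exact: pre_block_unit.
have dP := @class_diag_mask (pre r j).
move=> k l nkl; rewrite /entry mxE -!/(entry _ k l).
rewrite (class_diagM (class_diagM dP dW) dP nkl) add0r.
exact: supportedB class_diag1 dP _ _ nkl.
Qed.

(* [X] normalizes [(I - L, W)]: [(I - regression W)] makes [W] level-diagonal,
   and the strong component blocks of [I - L] are divided out. *)
Lemma exists_normalizer L W : RDreg G L -> PDB G W ->
  exists2 X, X \in unitmx & [/\ class_diag G X,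
    strictly_upper (level G) (1%:M - (1%:M - L) *m X) &
    level_diag (level G) (X^T *m W *m X)].
Proof.
move=> [sL uL] bW; have dW := class_diag_PDB bW; have pW := proj1 bW.
set r := level G; set D := diag_part r (1%:M - L); set A := regression r W.
have upL := upper_RD sL; have uD : D \in unitmx by apply: diag_part_unit.
have uDi : invmx D \in unitmx by rewrite unitmx_inv.
have dDi : level_diag r (invmx D).
  by apply: level_diag_inv => //; apply: level_diag_diag_part.
have sA : strictly_upper r A by apply: strictly_upper_regression.
exists ((1%:M - A) *m invmx D); first by rewrite unitmx_mul regression_unit.
split.
- apply: class_diagM; last exact: class_diag_inv uD (class_diag_diag_part sL).
  by apply: supportedB; [apply: class_diag1 | apply: class_diag_regression].
(* The diagonal blocks of I - A are identities, so this factor leaves the diagonal blocks of I - L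
   unchanged. *)
- have eD : diag_part r ((1%:M - L) *m (1%:M - A)) = D.
    rewrite diag_partM //; last exact: upper1B.
    suff -> : diag_part r (1%:M - A) = 1%:M by rewrite mulmx1.
    apply: eq_entry => i j; rewrite entry_mx_of entryB entry1.
    case: eqP => [rij|nij]; first by rewrite sA ?subr0 // rij ltnn.
    by case: (i =P j) nij => [->|]; rewrite ?subr0.
  rewrite mulmxA -eD; apply: strictly_upper_normalize; rewrite ?eD //.
  by apply: upperM => //; apply: upper1B.
- have -> : ((1%:M - A) *m invmx D)^T *m W *m ((1%:M - A) *m invmx D) =
    (invmx D)^T *m residual r W *m invmx D by rewrite /residual trmx_mul !mulmxA.
  apply: level_diagM => //; apply: level_diagM; last exact: level_diag_residual.
  exact: level_diagT.
Qed.

(** Gluing is the inverse: column [j] of L is seen by the component of its class, which contains the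
    parents of [j], and every nonzero entry of W lies within one class. Invertibility of I - L
    transfers by [restrict_unitP]. *)
Lemma set_bij_pi_map : set_bij (params R G) (prod_params R G) (pi_map R G).
Proof.
have dirE L : RD G L -> glue_dir (fun C => pi_dir C L) = L.
  move=> sL; apply: glue_pi_dir => i j nij; apply: sL.
  by apply: contraNN nij; apply: dir_vset.
split.
- move=> [L W] [[/= sL uL] bW] C; split=> /=.
    split; last by rewrite -restrict_1B; apply: (restrict_unitP sL).1.
    move=> i j nij; rewrite entry_mx_of; case: ifP => // jC; apply: sL.
    by apply: contraNN nij; rewrite /= /dir_comp jC andbT.
  split; last by move=> i niC; rewrite entry_mx_of (negPf niC) eqxx.
  split; first exact: PD_pi_bidir (proj1 bW).
  move=> i j nij nb; rewrite entry_mx_of (negPf nij) /=.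
  case: ifP => // /andP[iC jC]; apply: (proj2 bW); first by rewrite (inj_eq val_inj).
  by apply: contraNN nb; rewrite /= /bidir_comp iC jC !andbT.
- move=> [L W] [L' W'] /set_mem [[/= sL _] bW] /set_mem [[/= sL' _] bW'] e.
  have eL C : pi_dir C L = pi_dir C L' by have /(congr1 (fun p => (p C).1)) := e.
  have eW C : pi_bidir C W = pi_bidir C W' by have /(congr1 (fun p => (p C).2)) := e.
  rewrite -(dirE L) // -(dirE L') // -(glue_pi_bidir (class_diag_PDB bW)).
  rewrite -(glue_pi_bidir (class_diag_PDB bW')).
  congr pair; [congr glue_dir|congr glue_bidir]; exact: functional_extensionality_dep.
- move=> q pq; pose L := glue_dir (fun C => (q C).1).
  pose W := glue_bidir (fun C => (q C).2).
  have eL C : pi_dir C L = (q C).1.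
    rewrite (@pi_dir_glue _ _ _ (fun C => (q C).1)) // => i j njC.
    by case: (pq C) => -[sq _] _; apply: sq; rewrite /= /dir_comp (negPf njC) andbF.
  have eW C : pi_bidir C W = (q C).2.
    rewrite (@pi_bidir_glue _ _ _ (fun C => (q C).2)) // => i j nij.
    case: (pq C) => _ [[_ bq] q1].
    case: (i =P j) nij => [-> /=|/eqP nij nC /=].
      by rewrite andbb => jC; rewrite q1 // jC.
    apply: bq => //; apply: contraNN nC; by rewrite /= /bidir_comp => /and3P[_ -> ->].
  have sL : RD G L.
    move=> i j nij; rewrite entry_mx_of; apply: extend_eq0 => i' j' ei ej.
    case: (pq (class G j)) => -[sq _] _; apply: sq.
    by apply: contraNN nij; rewrite /= /dir_comp ei ej => /andP[].
  exists (L, W); last first.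
    apply: functional_extensionality_dep => C.
    by rewrite /pi_map /= eL eW -surjective_pairing.
  split=> /=; split=> //.
  + apply/(restrict_unitP sL) => C; rewrite restrict_1B eL.
    by case: (pq C) => -[].
  + by apply: PD_glue_bidir => C; case: (pq C) => _ [[]].
  move=> i j nij nb; rewrite entry_mx_of; case: ifP => // _.
  apply: extend_eq0 => i' j' ei ej.
  case: (pq (class G j)) => _ [[_ bq] _]; apply: bq.
    by apply: contraNneq nij => eij; rewrite -ei eij ej.
  by apply: contraNN nb; rewrite /= /bidir_comp ei ej => /andP[].
Qed.

Definition tau S : comp_mx R G := fun C =>
  phi (pi_dir C (regression (level G) S), pi_bidir C (residual (level G) S)).

Definition tau_inv (S : comp_mx R G) : 'M[R]_#|V| :=
  phi (glue_dir (fun C => regression (@clevel _ _ C) (S C)),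
       glue_bidir (fun C => residual (@clevel _ _ C) (S C))).

(** [pi_dir] keeps the regression matrix strictly upper, so I minus it is invertible for every
    positive definite [S], in the model or not. *)
Lemma tau_PD S : PD R V S -> prod_PD R G (tau S).
Proof.
move=> pS C; apply: PD_phi; first by apply/PD_pi_bidir/PD_residual.
apply: (strictly_upper_unit (r := @clevel _ _ C)).
exact/strictly_upper_pi_dir/strictly_upper_regression.
Qed.

Lemma tau_inv_unit (S : comp_mx R G) : prod_PD R G S ->
  1%:M - glue_dir (fun C => regression (@clevel _ _ C) (S C)) \in unitmx.
Proof.
move=> pS; apply: (strictly_upper_unit (r := level G)) => i j nij.
rewrite entry_mx_of; apply: extend_eq0 => i' j' ei ej.
by apply: strictly_upper_regression; rewrite // /clevel ei ej.
Qed.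

Lemma tau_inv_PD (S : comp_mx R G) : prod_PD R G S -> PD R V (tau_inv S).
Proof.
move=> pS; apply: PD_phi (tau_inv_unit pS).
by apply: PD_glue_bidir => C; apply: PD_residual.
Qed.

(** The restriction of a normalizer X of (L, W) normalizes the component parameters. So the
    decomposition on each component is the image of (A, D) under [pi_dir] and [pi_bidir];
    recomposing gives the first identity, and gluing these images back to (A, D) the second. *)
Lemma tau_phi p : params R G p ->
  tau (phi p) = prod_phi (pi_map R G p) /\ tau_inv (prod_phi (pi_map R G p)) = phi p.
Proof.
case: p => L W [/= rL bW]; have pW := proj1 bW; have [sL uL] := rL.
have dW := class_diag_PDB bW.
have [X uX [dX upX diX]] := exists_normalizer rL bW.
set A := 1%:M - _ in upX; set D := _ *m X in diX.
have dD : class_diag G D.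
  exact: class_diagM (class_diagM (class_diagT dX) dW) dX.
have resA C : 1%:M - (1%:M - pi_dir C L) *m restrict C X = pi_dir C A.
  by rewrite -[RHS](subKr 1%:M) -(restrict_1B C A) /A subKr restrictM // restrict_1B.
have resD C : (restrict C X)^T *m pi_bidir C W *m restrict C X = pi_bidir C D.
  rewrite !restrict_bidir // -restrictT // -!restrictM //.
have upC C : strictly_upper (@clevel _ _ C) (1%:M - (1%:M - pi_dir C L) *m restrict C X).
  by rewrite resA; apply: strictly_upper_pi_dir.
have diC C : level_diag (@clevel _ _ C)
    ((restrict C X)^T *m pi_bidir C W *m restrict C X).
  by rewrite resD; apply: level_diag_pi_bidir.
have pWC C : PD R _ (pi_bidir C W) by apply: PD_pi_bidir.
have uLC C : 1%:M - pi_dir C L \in unitmx.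
  by rewrite -restrict_1B; apply: (restrict_unitP sL).1.
have uXC C : restrict C X \in unitmx by apply: restrict_unit.
have regE : regression (level G) (phi (L, W)) = A := regression_phi pW uL upX diX.
have resE : residual (level G) (phi (L, W)) = D := residual_phi pW uL upX diX.
have phiE : phi (A, D) = phi (L, W) := phi_regression_residual W uL uX.
have regCE C : regression (@clevel _ _ C) (phi (pi_dir C L, pi_bidir C W)) = pi_dir C A.
  by rewrite -resA; apply: regression_phi.
have resCE C : residual (@clevel _ _ C) (phi (pi_dir C L, pi_bidir C W)) = pi_bidir C D.
  by rewrite -resD; apply: residual_phi.
split.
  apply: functional_extensionality_dep => C; rewrite /tau regE resE -resA -resD.
  exact: (phi_regression_residual (pi_bidir C W) (uLC C) (uXC C)).
suff [gA gD] : glue_dir (fun C => pi_dir C A) = A /\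
    glue_bidir (fun C => pi_bidir C D) = D.
  have eA : (fun C => regression (@clevel _ _ C) (prod_phi (pi_map R G (L, W)) C)) =
      (fun C => pi_dir C A) by exact: functional_extensionality_dep.
  have eD : (fun C => residual (@clevel _ _ C) (prod_phi (pi_map R G (L, W)) C)) =
      (fun C => pi_bidir C D) by exact: functional_extensionality_dep.
  by rewrite /tau_inv eA eD gA gD.
split; last exact: glue_pi_bidir.
(* An off-diagonal nonzero entry of [A] at (i, j) comes from some k in the class of j with i = k or
   an edge i -> k; either way i lies in V[C] for the class C of j. *)
apply: glue_pi_dir.
  move=> i j nij; rewrite entryB entry1 entryM big1 => [|k _].
    by case: (i =P j) nij => [->|]; rewrite ?subr0 // mem_vset // mem_class.
  have [/eqP ekj|/dX ->] := boolP (class G k == class G j); last by rewrite mulr0.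
  rewrite entryB entry1 sL; last by apply: contraNN nij; rewrite -ekj; apply: dir_vset.
  case: (i =P k) nij => [->|]; rewrite ?subr0 ?mul0r //.
  by rewrite mem_vset // mem_class ekj.
Qed.

End Decomposition.

(** * Closure properties of rational functions without poles on a set *)

Section RationalFunctions.
Variables (R : realType) (T : Type) (I : finType) (coord : T -> I -> R) (D : set T).
Implicit Types f g : T -> R.
Local Notation rational := (rational_on coord D).

Lemma rational_ext f g : (forall x, D x -> f x = g x) -> rational f -> rational g.
Proof. by move=> efg [p [q pq]]; exists p, q => x Dx; rewrite -efg //; apply: pq. Qed.

Lemma rational_cst c : rational (fun=> c).
Proof.
exists (mpoly.mpolyC _ c), 1 => x _ /=.
by rewrite mpoly.meval1 oner_neq0 mpoly.mevalC divr1.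
Qed.

Lemma rational_coord i : rational (coord^~ i).
Proof.
exists (mpoly.mpolyX R (mpoly.mnm1 (enum_rank i))), 1 => x _ /=.
by rewrite mpoly.meval1 oner_neq0 mpoly.mevalXU divr1 enum_rankK.
Qed.

Lemma rationalD f g : rational f -> rational g -> rational (fun x => f x + g x).
Proof.
move=> [p [q pq]] [p' [q' pq']]; exists (p * q' + p' * q), (q * q') => x Dx v.
have [q0 ->] := pq x Dx; have [q'0 ->] := pq' x Dx.
by rewrite mpoly.mevalD !mpoly.mevalM mulf_neq0 ?addf_div.
Qed.

Lemma rationalM f g : rational f -> rational g -> rational (fun x => f x * g x).
Proof.
move=> [p [q pq]] [p' [q' pq']]; exists (p * p'), (q * q') => x Dx v.
have [q0 ->] := pq x Dx; have [q'0 ->] := pq' x Dx.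
by rewrite !mpoly.mevalM mulf_neq0 ?mulf_div.
Qed.

Lemma rationalV f : (forall x, D x -> f x != 0) -> rational f ->
  rational (fun x => (f x)^-1).
Proof.
move=> f0 [p [q pq]]; exists q, p => x Dx v.
have [q0 fE] := pq x Dx; rewrite fE invf_div; split=> //.
by apply: contraNneq (f0 x Dx) => p0; rewrite fE p0 mul0r.
Qed.

Lemma rational_sum (J : Type) (s : seq J) (P : pred J) (F : J -> T -> R) :
  (forall j, rational (F j)) -> rational (fun x => \sum_(j <- s | P j) F j x).
Proof.
move=> rF; elim: s => [|j s IHs].
  by apply: rational_ext (rational_cst 0) => x _; rewrite big_nil.
have [Pj|nPj] := boolP (P j).
  by apply: rational_ext (rationalD (rF j) IHs) => x _; rewrite big_cons Pj.
by apply: rational_ext IHs => x _; rewrite big_cons (negPf nPj).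
Qed.

Lemma rational_prod (J : Type) (s : seq J) (P : pred J) (F : J -> T -> R) :
  (forall j, rational (F j)) -> rational (fun x => \prod_(j <- s | P j) F j x).
Proof.
move=> rF; elim: s => [|j s IHs].
  by apply: rational_ext (rational_cst 1) => x _; rewrite big_nil.
have [Pj|nPj] := boolP (P j).
  by apply: rational_ext (rationalM (rF j) IHs) => x _; rewrite big_cons Pj.
by apply: rational_ext IHs => x _; rewrite big_cons (negPf nPj).
Qed.

Definition rational_mx m n (F : T -> 'M[R]_(m, n)) :=
  forall i j, rational (fun x => F x i j).

Lemma rational_mx_cst m n (A : 'M[R]_(m, n)) : rational_mx (fun=> A).
Proof. by move=> i j; apply: rational_cst. Qed.

Lemma rational_mxT m n (F : T -> 'M[R]_(m, n)) :
  rational_mx F -> rational_mx (fun x => (F x)^T).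
Proof. by move=> rF i j; apply: rational_ext (rF j i) => x _; rewrite mxE. Qed.

Lemma rational_mxM m n p (F : T -> 'M[R]_(m, n)) (H : T -> 'M[R]_(n, p)) :
  rational_mx F -> rational_mx H -> rational_mx (fun x => F x *m H x).
Proof.
move=> rF rH i j.
apply: (rational_ext (f := fun x => \sum_k F x i k * H x k j)) => [x _|].
  by rewrite mxE.
by apply: rational_sum => k; apply: rationalM.
Qed.

Lemma rational_mxD m n (F H : T -> 'M[R]_(m, n)) :
  rational_mx F -> rational_mx H -> rational_mx (fun x => F x + H x).
Proof.
move=> rF rH i j.
by apply: rational_ext (rationalD (rF i j) (rH i j)) => x _; rewrite mxE.
Qed.

Lemma rational_mxB m n (F H : T -> 'M[R]_(m, n)) :
  rational_mx F -> rational_mx H -> rational_mx (fun x => F x - H x).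
Proof.
move=> rF rH; apply: rational_mxD => // i j.
apply: rational_ext (rationalM (rational_cst (-1)) (rH i j)) => x _.
by rewrite mxE mulN1r.
Qed.

Lemma rational_det n (F : T -> 'M[R]_n) : rational_mx F -> rational (fun x => \det (F x)).
Proof.
move=> rF; apply: rational_sum => s.
by apply: rationalM (rational_cst _) _; apply: rational_prod.
Qed.

(** Cramer's rule: the entries are cofactors divided by the determinant, which has no zero on
    [D]. *)
Lemma rational_invmx n (F : T -> 'M[R]_n) : (forall x, D x -> F x \in unitmx) ->
  rational_mx F -> rational_mx (fun x => invmx (F x)).
Proof.
move=> uF rF i j; have rC : rational (fun x => cofactor (F x) j i).
  apply: rationalM (rational_cst _) _; apply: rational_det => k l.
  by apply: rational_ext (rF (lift j k) (lift i l)) => x _; rewrite !mxE.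
have r_inv : rational (fun x => (\det (F x))^-1).
  by apply: rationalV (rational_det rF) => x /uF; rewrite unitmxE unitfE.
by apply: rational_ext (rationalM r_inv rC) => x Dx; rewrite /invmx uF // !mxE.
Qed.

Lemma rational_mx_of (J : finType) (F : T -> J -> J -> R) :
  (forall i j, rational (fun x => F x i j)) -> rational_mx (fun x => mx_of (F x)).
Proof.
by move=> rF i j; apply: rational_ext (rF (enum_val i) (enum_val j)) => x _; rewrite mxE.
Qed.

Lemma rational_phi (J : finType) (L W : T -> 'M[R]_#|J|) :
    (forall x, D x -> 1%:M - L x \in unitmx) -> rational_mx L -> rational_mx W ->
  rational_mx (fun x => phi (L x, W x)).
Proof.
move=> uL rL rW.
have rM : rational_mx (fun x => invmx (1%:M - L x)).
  by apply: rational_invmx => //; apply: rational_mxB => //; apply: rational_mx_cst.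
by do 2![apply: rational_mxM => //]; apply: rational_mxT.
Qed.

Lemma rational_regression (J : finType) (r : J -> nat) (S : T -> 'M[R]_#|J|) :
    (forall x, D x -> PD R J (S x)) -> rational_mx S ->
  rational_mx (fun x => regression r (S x)).
Proof.
move=> pS rS; apply: rational_mx_of => i j.
have rP := rational_mx_cst (diag_mask R (pre r j)).
apply: (rational_mxM 
  (F := fun x => invmx (pre_block r (S x) j) *m diag_mask R (pre r j))) => //.
apply: rational_mxM => //; apply: rational_invmx => [x /pS|]; first exact: pre_block_unit.
apply: rational_mxD; first by apply: rational_mxM => //; apply: rational_mxM.
exact: rational_mx_cst.
Qed.

Lemma rational_residual (J : finType) (r : J -> nat) (S : T -> 'M[R]_#|J|) :
    (forall x, D x -> PD R J (S x)) -> rational_mx S ->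
  rational_mx (fun x => residual r (S x)).
Proof.
move=> pS rS; have rA : rational_mx (fun x => 1%:M - regression r (S x)).
  by apply: rational_mxB; [apply: rational_mx_cst | apply: rational_regression].
by do 2![apply: rational_mxM => //]; apply: rational_mxT.
Qed.

End RationalFunctions.

(** * Rationality of [tau] and [tau_inv] *)

Section RationalMaps.
Variables (R : realType) (V : finType) (G : mixed_graph V).

Lemma rational_tau :
  rational_map_on (mx_coord R V) (comp_mx_coord R G) (PD R V) (tau (G := G)).
Proof.
have rS : rational_mx (mx_coord R V) (PD R V) id.
  move=> a b; apply: rational_ext (rational_coord _ _ (enum_val a, enum_val b)) => S _.
  by rewrite /mx_coord /entry !enum_valK.
move=> [C [i j]]; rewrite /comp_mx_coord /=.
apply: (rational_phi (L := fun S => pi_dir C (regression (level G) S))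
  (W := fun S => pi_bidir C (residual (level G) S))).
- move=> S pS; apply: (strictly_upper_unit (r := @clevel _ _ C)).
  exact/strictly_upper_pi_dir/strictly_upper_regression.
- apply: rational_mx_of => k l /=; case: (_ \in _); last exact: rational_cst.
  exact: (rational_regression (level G) _ rS).
- apply: rational_mx_of => k l /=; case: (_ && _).
  2: by case: (_ && _); apply: rational_cst.
  exact: (rational_residual (level G) _ rS).
Qed.

Lemma rational_tau_inv :
  rational_map_on (comp_mx_coord R G) (mx_coord R V) (prod_PD R G) (@tau_inv R V G).
Proof.
have rS C : rational_mx (comp_mx_coord R G) (prod_PD R G) (fun S => S C).
  move=> a b; apply: rational_ext (rational_coord _ _
    (Tagged (fun C : comp_index G => (vcomp C * vcomp C)%type)
      (enum_val a, enum_val b))) => S _.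
  by rewrite /comp_mx_coord /entry /= !enum_valK.
have pS C (S : comp_mx R G) : prod_PD R G S -> PD R (vcomp C) (S C) by [].
have r_ext C (F : comp_mx R G -> 'M[R]_#|vcomp C|) i j :
    rational_mx (comp_mx_coord R G) (prod_PD R G) F ->
    rational_on (comp_mx_coord R G) (prod_PD R G) (fun S => extend (F S) i j).
  move=> rF; rewrite /extend; case: insub => [i'|]; last exact: rational_cst.
  by case: insub => [j'|]; [apply: rF | apply: rational_cst].
move=> [i j]; rewrite /mx_coord /=.
apply: (rational_phi
  (L := fun S : comp_mx R G => glue_dir (fun C => regression (@clevel _ _ C) (S C)))
  (W := fun S : comp_mx R G => glue_bidir (fun C => residual (@clevel _ _ C) (S C)))).
- exact: tau_inv_unit.
- apply: rational_mx_of => k l /=; apply: r_ext.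
  by apply: rational_regression (rS _) => S /pS.
- apply: rational_mx_of => k l /=; case: (_ == _); last exact: rational_cst.
  by apply: r_ext; apply: rational_residual (rS _) => S /pS.
Qed.

End RationalMaps.

Theorem theorem6p1 (R : realType) (V : finType) (G : mixed_graph V) :
  set_bij (params R G) (prod_params R G) (pi_map R G) /\
  exists (tau : 'M[R]_#|V| -> comp_mx R G) (taui : comp_mx R G -> 'M[R]_#|V|),
    [/\ set_fun (PD R V) (prod_PD R G) tau,
        set_fun (prod_PD R G) (PD R V) taui,
        rational_map_on (mx_coord R V) (comp_mx_coord R G) (PD R V) tau &
        rational_map_on (comp_mx_coord R G) (mx_coord R V) (prod_PD R G) taui] /\
    [/\ (forall p, params R G p -> tau (phi p) = prod_phi (pi_map R G p)),
        set_bij (model R G) (prod_model R G) tau,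
        (forall S, model R G S -> taui (tau S) = S) &
        (forall S, prod_model R G S -> tau (taui S) = S)].
Proof.
have pi_bij := @set_bij_pi_map R V G; have [pi_fun _ pi_surj] := pi_bij.
have tauK (p : 'M[R]_#|V| * 'M[R]_#|V|) : params R G p ->
    tau_inv (tau (G := G) (phi p)) = phi p.
  by move=> /tau_phi[-> ->].
have modelK S : model R G S -> tau_inv (tau (G := G) S) = S by case=> p /tauK e <-.
(* As [pi_map] is onto, every point of [prod_model] is the image under [tau] of a point of [model];
   the left inverse on [model] is therefore also a right inverse. *)
have prod_modelE (S : comp_mx R G) : prod_model R G S ->
    exists2 p, params R G p & S = tau (G := G) (phi p).
  move=> [q /pi_surj[p pp <-] <-]; exists p => //.
  by have [-> _] := tau_phi pp.
split=> //; exists (@tau R V G), (@tau_inv R V G); split.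
  split; [exact: tau_PD | exact: tau_inv_PD
         | exact: rational_tau | exact: rational_tau_inv].
split=> // [p /tau_phi[] //||S /prod_modelE[p pp ->]]; last by rewrite tauK.
split.
- move=> S [p pp <-]; exists (pi_map R G p); first exact: pi_fun.
  by have [-> _] := tau_phi pp.
- move=> S S' /set_mem mS /set_mem mS' eS.
  by rewrite -(modelK S) // eS modelK.
- by move=> S /prod_modelE[p pp ->]; exists (phi p) => //; exists p.
Qed.
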